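(* Let $m,n,d\in\mathbb{N}$, let $\ell:\mathbb{R}^{m\times n}\to\mathbb{R}$ be locally Lipschitz, and let $f:\mathbb{R}^{d\times m}\times\mathbb{R}^{d\times n}\to\mathbb{R}$, $f(X,Y):=\ell(X^{\mathrm T}Y)$. Then, writing $O$ for the origin of $\mathbb{R}^{d\times m}\times\mathbb{R}^{d\times n}$, $$\partial_C f(O)=\partial f(O)=\widehat\partial f(O)=\{O\},$$ and $f$ is strictly differentiable at $O$ with $\nabla f(O)=O$.
   Context: $\mathbb{N}$ is the set of positive integers. $\mathbb{R}^{d\times m}\times\mathbb{R}^{d\times n}$ is identified with $\mathbb{R}^{d\times(m+n)}$, a Euclidean space with the Frobenius inner product. For a locally Lipschitz $f:\mathbb{R}^N\to\mathbb{R}$ and $x\in\mathbb{R}^N$: the Fréchet subdifferential is $\widehat\partial f(x):=\{s:\liminf_{y\to x,\,y\ne x}\frac{f(y)-f(x)-\langle s,y-x\rangle}{\|y-x\|}\ge0\}$; the limiting subdifferential $\partial f(x)$ is the set of all $s$ for which there exist $y_k\to x$ with $f(y_k)\to f(x)$ and $s_k\in\widehat\partial f(y_k)$ with $s_k\to s$; the Clarke subdifferential is $\partial_C f(x):=\operatorname{conv}\{s:\exists\, y_k\to x,\ f\text{ differentiable at each }y_k,\ \nabla f(y_k)\to s\}$. Strict differentiability at $x$ with gradient $v$ means $\frac{f(y)-f(z)-\langle v,y-z\rangle}{\|y-z\|}\to0$ as $y,z\to x$ with $y\ne z$. *)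

(* Defs.v *)
From HB Require Import structures.
From mathcomp Require Import all_boot all_order all_algebra.
From mathcomp Require Import all_classical all_reals all_analysis.

Set Implicit Arguments.
Unset Strict Implicit.
Unset Printing Implicit Defensive.

Import Order.TTheory GRing.Theory Num.Theory.
Import numFieldNormedType.Exports.

Local Open Scope classical_set_scope.
Local Open Scope ring_scope.

(* The library norm `|A| on matrices is the sup norm.  It is used here only
   through notions that do not change under an equivalent norm (nbhs, limits,
   differentiability, lipschitz up to the constant); whenever the value of the
   norm or the inner product enters a formula, it is the Frobenius one. *)
Section Subdifferentials.
Context {R : realType} {p q : nat}.
Implicit Types (f : 'M[R]_(p, q) -> R) (x y z s g v : 'M[R]_(p, q)).

Definition frob_dot (A B : 'M[R]_(p, q)) : R := \tr (A^T *m B).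

Definition frob_norm (A : 'M[R]_(p, q)) : R := Num.sqrt (frob_dot A A).

Definition locally_lipschitz f : Prop :=
  forall x, exists2 U, nbhs x U & [lipschitz f y | y in U].

Definition frechet_subdiff f x : set 'M[R]_(p, q) :=
  [set s | (0 <= limf_einf (fun y =>
      ((f y - f x - frob_dot s (y - x)) / frob_norm (y - x))%:E) x^')%E].

Definition limiting_subdiff f x : set 'M[R]_(p, q) :=
  [set s | exists y_ s_ : nat -> 'M[R]_(p, q),
    [/\ y_ k @[k --> \oo] --> x,
        f (y_ k) @[k --> \oo] --> f x,
        forall k, frechet_subdiff f (y_ k) (s_ k)
      & s_ k @[k --> \oo] --> s]].

Definition has_gradient f x g : Prop :=
  differentiable f x /\ forall h, 'd f x h = frob_dot g h.

Definition convex_hull (A : set 'M[R]_(p, q)) : set 'M[R]_(p, q) :=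
  smallest (@convex_set R 'M[R]_(p, q)) A.

Definition clarke_subdiff f x : set 'M[R]_(p, q) :=
  convex_hull [set s | exists y_ g_ : nat -> 'M[R]_(p, q),
    [/\ y_ k @[k --> \oo] --> x,
        forall k, has_gradient f (y_ k) (g_ k)
      & g_ k @[k --> \oo] --> s]].

Definition strictly_differentiable f x v : Prop :=
  (f yz.1 - f yz.2 - frob_dot v (yz.1 - yz.2)) / frob_norm (yz.1 - yz.2)
    @[yz --> within [set yz | yz.1 != yz.2] (nbhs (x, x))] --> (0 : R).

End Subdifferentials.

(* Main.v *)
(* The map (X, Y) |-> X^T Y is quadratic, so on a small ball around the origin
   it is Lipschitz with a constant proportional to the radius.  Composing it
   with the locally Lipschitz [ell] preserves this, so difference quotients of
   [f] tend to 0 and [f] is strictly differentiable at 0 with gradient 0.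
   Strict differentiability at x with gradient v forces every Frechet
   subgradient at a point near x to be close to v: test the subgradient
   inequality at y along the direction s - v.  A gradient is a Frechet
   subgradient, so all three subdifferentials at x reduce to {v}. *)

Require Import Defs.
From HB Require Import structures.
From mathcomp Require Import all_boot all_order all_algebra.
From mathcomp Require Import all_classical all_reals all_analysis.
From mathcomp Require Import ring lra.

Set Implicit Arguments.
Unset Strict Implicit.
Unset Printing Implicit Defensive.

Import Order.TTheory GRing.Theory Num.Theory.
Import numFieldNormedType.Exports.

Local Open Scope classical_set_scope.
Local Open Scope ring_scope.

(** * Sup norm and entries of a matrix *)

Lemma mx_entry_le (R : realType) (p q : nat) (A : 'M[R]_(p, q)) i j :
  `|A i j| <= `|A|.
Proof.
by rewrite [leRHS]/Num.norm /= mx_normrE; apply/bigmax_geP; right; exists (i, j).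
Qed.

Lemma mx_norm_le (R : realType) (p q : nat) (A : 'M[R]_(p, q)) (b : R) :
  0 <= b -> (forall i j, `|A i j| <= b) -> `|A| <= b.
Proof.
move=> b0 Ab; rewrite [leLHS]/Num.norm /= mx_normrE.
by apply/bigmax_leP; split => // -[i j] _; exact: Ab.
Qed.

(** * Frobenius inner product, and its norm compared with the sup norm *)

Section FrobeniusTheory.
Context {R : realType} {p q : nat}.
Implicit Types (A B C : 'M[R]_(p, q)).

Lemma frob_dotE A B : frob_dot A B = \sum_j \sum_i A i j * B i j.
Proof.
rewrite /frob_dot /mxtrace; apply: eq_bigr => j _; rewrite mxE.
by apply: eq_bigr => i _; rewrite mxE.
Qed.

Lemma frob_dot_is_linear A : linear (frob_dot A : 'M[R]_(p, q) -> R^o).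
Proof. by move=> k B C; rewrite /frob_dot mulmxDr -scalemxAr mxtraceD mxtraceZ. Qed.

(** The linear structure lets [frob_dot A] stand as a candidate differential. *)
HB.instance Definition _ A := GRing.isLinear.Build R 'M[R]_(p, q) R^o _
  (frob_dot A) (frob_dot_is_linear A).

Lemma frob_dotBr A B C : frob_dot A (B - C) = frob_dot A B - frob_dot A C.
Proof. exact: linearB. Qed.

Lemma frob_dotZr A k B : frob_dot A (k *: B) = k * frob_dot A B.
Proof. by rewrite /frob_dot -scalemxAr mxtraceZ. Qed.

Lemma frob_dotC A B : frob_dot A B = frob_dot B A.
Proof. by rewrite /frob_dot -mxtrace_tr trmx_mul trmxK. Qed.

Lemma frob_dotBl A B C : frob_dot (A - B) C = frob_dot A C - frob_dot B C.
Proof. by rewrite !(frob_dotC _ C) frob_dotBr. Qed.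

Lemma frob_dot0l B : frob_dot 0 B = 0.
Proof. by rewrite -(subrr 0) frob_dotBl subrr. Qed.

Lemma frob_dot_ge0 A : 0 <= frob_dot A A.
Proof.
by rewrite frob_dotE; do 2![apply: sumr_ge0 => ? _]; rewrite -expr2 sqr_ge0.
Qed.

(** A crude Cauchy-Schwarz bound in the sup norm, one term per entry; it yields both continuity of
    the pairing and one half of the norm equivalence. *)
Lemma norm_frob_dot_le A B : `|frob_dot A B| <= (p * q)%:R * (`|A| * `|B|).
Proof.
rewrite frob_dotE (le_trans (ler_norm_sum _ _ _))//.
have bound j : `|\sum_i A i j * B i j| <= p%:R * (`|A| * `|B|).
  rewrite (le_trans (ler_norm_sum _ _ _))//.
  rewrite (le_trans (ler_sum _ (G := fun=> `|A| * `|B|) _))//.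
    by move=> i _; rewrite normrM ler_pM// mx_entry_le.
  by rewrite sumr_const card_ord mulr_natl.
rewrite (le_trans (ler_sum _ (fun j _ => bound j)))//.
by rewrite sumr_const card_ord mulnC natrM -mulrA [leRHS]mulr_natl.
Qed.

Lemma frob_norm_ge0 A : 0 <= frob_norm A.
Proof. exact: sqrtr_ge0. Qed.

Lemma frob_norm0 : frob_norm (0 : 'M[R]_(p, q)) = 0.
Proof. by rewrite /frob_norm frob_dot0l sqrtr0. Qed.

Lemma frob_normZ k A : 0 <= k -> frob_norm (k *: A) = k * frob_norm A.
Proof.
move=> k0; rewrite /frob_norm frob_dotZr frob_dotC frob_dotZr mulrA -expr2.
by rewrite sqrtrM ?sqr_ge0// sqrtr_sqr ger0_norm.
Qed.

Lemma frob_norm_sqr A : frob_norm A ^+ 2 = frob_dot A A.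
Proof. by rewrite sqr_sqrtr// frob_dot_ge0. Qed.

Lemma mx_norm_le_frob A : `|A| <= frob_norm A.
Proof.
apply: mx_norm_le => [|i j]; first exact: frob_norm_ge0.
rewrite -sqrtr_sqr /frob_norm ler_sqrt ?frob_dot_ge0// frob_dotE.
rewrite (bigD1 j)//= (bigD1 i)//= -expr2 -addrA lerDl addr_ge0//; last first.
  by apply: sumr_ge0 => ? _; apply: sumr_ge0 => ? _; rewrite -expr2 sqr_ge0.
by apply: sumr_ge0 => ? _; rewrite -expr2 sqr_ge0.
Qed.

Lemma frob_norm_le_mx_norm A : frob_norm A <= Num.sqrt (p * q)%:R * `|A|.
Proof.
rewrite -[`|A|]ger0_norm// -sqrtr_sqr -sqrtrM ?ler0n// ler_sqrt; last first.
  by rewrite mulr_ge0// sqr_ge0.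
by rewrite (le_trans (ler_norm _))// (le_trans (norm_frob_dot_le _ _)).
Qed.

Lemma frob_norm_gt0 A : (0 < frob_norm A) = (A != 0).
Proof.
have [->|A0] := eqVneq A 0; first by rewrite frob_norm0 ltxx.
by rewrite (lt_le_trans _ (mx_norm_le_frob A))// normr_gt0.
Qed.

Lemma frob_dot_continuous A : continuous (frob_dot A : 'M[R]_(p, q) -> R).
Proof.
apply: (@bounded_linear_continuous R 'M[R]_(p, q) R^o (frob_dot A)).
apply/linear_boundedP.
apply: filterS (nbhs_pinfty_ge (num_real ((p * q)%:R * `|A|))) => r /= rA B.
by rewrite (le_trans (norm_frob_dot_le _ _))// mulrA ler_wpM2r.
Qed.

End FrobeniusTheory.

(** * Differentiability as an epsilon estimate *)

Lemma differentiable_near (R : numFieldType) (V W : normedModType R)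
    (f : V -> W) (x : V) (e : R) : differentiable f x -> 0 < e ->
  \forall y \near x, `|f y - f x - 'd f x (y - x)| <= e * `|y - x|.
Proof.
move=> df e0; have /eqaddoP/(_ e e0) := diff_locally df.
rewrite /= (near_shift 0 x) => fe.
by apply: filterS fe => y; rewrite /= subr0 addrK !fctE opprD addrA.
Qed.

Lemma near_differentiable (R : numFieldType) (V W : normedModType R)
    (f : V -> W) (L : {linear V -> W}) (x : V) : continuous L ->
    (forall e, 0 < e ->
      \forall y \near x, `|f y - f x - L (y - x)| <= e * `|y - x|) ->
  differentiable f x /\ 'd f x = L :> (V -> W).
Proof.
move=> Lc fL.
have fE : f \o shift x = cst (f x) + L +o_ 0 id.
  apply/eqaddoP => e e0; have := fL e e0; rewrite /= (near_shift 0 x) => fe.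
  by apply: filterS fe => y; rewrite /= subr0 addrK !fctE opprD addrA.
have dE := diff_unique Lc fE.
by split=> //; apply/diff_locallyP; rewrite dE.
Qed.

(** * Subdifferentials at a point of strict differentiability *)

Section StrictDifferentiability.
Context {R : realType} {p q : nat}.
Implicit Types (f : 'M[R]_(p, q) -> R) (x y z s g v : 'M[R]_(p, q)).

(** The lower limit is freed of its quotient. At [y = x] both sides vanish, so a full neighbourhood
    replaces the punctured one. *)
Lemma frechet_subdiffP f x s : frechet_subdiff f x s <->
  forall e, 0 < e -> \forall y \near x,
    - e * frob_norm (y - x) <= f y - f x - frob_dot s (y - x).
Proof.
rewrite /frechet_subdiff /= limf_einfE; split=> [fs e e0|fs].
(* The lower limit is a supremum of infima over punctured neighbourhoods, so one of these infima
   already exceeds [- e]. *)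
- have : ((- e)%:E < ereal_sup [set ereal_inf [set
      ((f y - f x - frob_dot s (y - x)) / frob_norm (y - x))%:E | y in V]
      | V in x^'])%E.
    by rewrite (lt_le_trans _ fs)// lte_fin oppr_lt0.
  move=> /ereal_sup_gt[_ [V xV <-]] eV.
  move: xV; rewrite /dnbhs /within /= => xV; near=> y.
  have [->|yx] := eqVneq y x.
    by rewrite !subrr (linear0 (frob_dot s)) frob_norm0 mulr0 subrr.
  have Vy : V y by apply: (near xV y).
  rewrite -ler_pdivlMr ?frob_norm_gt0 ?subr_eq0//.
  rewrite -lee_fin (le_trans (ltW eV))//.
  by apply: ereal_inf_lbound; exists y.
- apply/lee_subgt0Pr => e e0; rewrite sub0e -EFinN.
  pose V := [set y | y != x /\
    - e * frob_norm (y - x) <= f y - f x - frob_dot s (y - x)].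
  apply: (@le_trans _ _ (ereal_inf [set
      ((f y - f x - frob_dot s (y - x)) / frob_norm (y - x))%:E | y in V])).
    apply/ereal_infP => _ [y [yx Vy] <-]; rewrite lee_fin.
    by rewrite ler_pdivlMr// frob_norm_gt0 subr_eq0.
  apply: ereal_sup_ubound; exists V => //.
  by rewrite /dnbhs /within /=; apply: filterS (fs e e0) => y ? ?; split.
Unshelve. all: by end_near. Qed.

Lemma strictly_differentiableP f x v : strictly_differentiable f x v <->
  forall e, 0 < e -> \forall y & z \near x,
    `|f y - f z - frob_dot v (y - z)| <= e * frob_norm (y - z).
Proof.
split=> [fv e e0|fv].
- move/cvgr0Pnorm_le : fv => /(_ e e0); rewrite near_withinE => fv.
  apply: filterS fv => -[y z] /= fyz.
  have [->|yz] := eqVneq y z.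
    by rewrite !subrr (linear0 (frob_dot v)) frob_norm0 mulr0 subrr normr0.
  have N0 : 0 < frob_norm (y - z) by rewrite frob_norm_gt0 subr_eq0.
  move: (fyz yz); rewrite normrM normfV (gtr0_norm N0).
  by rewrite ler_pdivrMr.
- apply/cvgr0Pnorm_le => e e0; rewrite near_withinE.
  apply: filterS (fv e e0) => -[y z] /= fyz yz.
  have N0 : 0 < frob_norm (y - z) by rewrite frob_norm_gt0 subr_eq0.
  by rewrite normrM normfV (gtr0_norm N0) ler_pdivrMr.
Qed.

(** Only the lower half of the two-sided first-order estimate is kept. *)
Lemma has_gradient_frechet_subdiff f x g :
  has_gradient f x g -> frechet_subdiff f x g.
Proof.
move=> [df dE]; apply/frechet_subdiffP => e e0.
apply: filterS (differentiable_near df e0) => y; rewrite dE ler_norml => /andP[].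
move=> + _; apply: le_trans; rewrite mulNr lerN2 ler_wpM2l ?(ltW e0)//.
exact: mx_norm_le_frob.
Qed.

(** Freezing the second point of the strict estimate at [x] gives the ordinary one. *)
Lemma strictly_differentiable_gradient f x v :
  strictly_differentiable f x v -> has_gradient f x v.
Proof.
move=> /strictly_differentiableP fv.
have [df dE] : differentiable f x /\ 'd f x = frob_dot v :> ('M[R]_(p, q) -> R).
  apply: near_differentiable; first exact: frob_dot_continuous.
  move=> e e0; pose c : R := Num.sqrt (p * q)%:R.
  (* [c] bounds the Frobenius norm by the sup norm; it is 0 for empty matrices, hence the division
     by [c + 1]. *)
  have c0 : 0 < c + 1 by rewrite ltr_pwDr// sqrtr_ge0.
  have ec0 : 0 < e / (c + 1) by rewrite divr_gt0.
  have [[A B] /= [xA xB] AB] := fv _ ec0.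
  apply: filterS xA => y Ay.
  have := AB (y, x) (conj Ay (nbhs_singleton xB)) => /le_trans; apply.
  rewrite mulrAC ler_pdivrMr// -mulrA ler_pM2l//.
  rewrite (le_trans (frob_norm_le_mx_norm _))// mulrC ler_wpM2l// lerDl//.
by split=> // h; rewrite dE.
Qed.

(** The key estimate. Near [x], increments of [f] follow [v] up to a small error, so a subgradient
    [s] at [y] cannot grow much faster than [v] in any direction, in particular along [s - v]. *)
Lemma strictly_differentiable_frechet_near f x v e :
  strictly_differentiable f x v -> 0 < e ->
  \forall y \near x, forall s, frechet_subdiff f y s -> `|s - v| <= e.
Proof.
move=> /strictly_differentiableP fv e0.
have e20 : 0 < e / 2 by rewrite divr_gt0.
have [[A B] /= [xA xB] AB] := fv _ e20.
near=> y => s /frechet_subdiffP/(_ _ e20) fs.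
have By : B y by near: y.
(* [y] stays fixed while a second point varies around it, so [A] must be a neighbourhood of [y], not
   merely contain it. *)
have Ay : nbhs y A by near: y; exact: nbhs_interior.
set w := s - v.
(* The subgradient inequality and the strict estimate each cost [e / 2]; subtracting them eliminates
   [f]. *)
have Cy : \forall z \near y, frob_dot w (z - y) <= e * frob_norm (z - y).
  near=> z.
  have /(AB (z, y)) : A z /\ B y by split => //; near: z.
  have /= : - (e / 2) * frob_norm (z - y) <= f z - f y - frob_dot s (z - y).
    by near: z.
  rewrite /w frob_dotBl /= ler_norml => H1 /andP[_ H2]; lra.
have ytw : (y + t *: w) @[t --> (0 : R)] --> y.
  rewrite -[X in _ --> X]addr0 -[X in _ + X](scale0r w).
  by apply: cvgD; [exact: cvg_cst|exact: cvgZr_tmp].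
(* Along [z = y + t *: w] both sides scale by [t]; cancelling it leaves
   [frob_norm w ^+ 2 <= e * frob_norm w]. *)
have [t [t0 Ct]] : exists t : R, 0 < t /\
    frob_dot w (y + t *: w - y) <= e * frob_norm (y + t *: w - y).
  have Cty : \forall t \near 0^'+, frob_dot w (y + t *: w - y) <=
      e * frob_norm (y + t *: w - y) := cvg_at_right_filter ytw Cy.
  by have [t [? ?]] := filter_ex (filterI (nbhs_right_gt 0) Cty); exists t.
move: Ct; rewrite [y + _]addrC addrK frob_dotZr (frob_normZ _ (ltW t0)).
rewrite -frob_norm_sqr [leRHS]mulrCA ler_pM2l// => we.
rewrite (le_trans (mx_norm_le_frob _))//.
have [w0|] := ltP 0 (frob_norm w); last by move/le_trans; apply; exact: ltW.
by move: we; rewrite expr2 ler_pM2r.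
Unshelve. all: by end_near. Qed.

Lemma convex_hull1 x : convex_hull [set x] = [set x].
Proof.
apply/seteqP; split=> [y|_ ->]; last by move=> A [_]; apply.
apply; split=> // y1 y2 t; rewrite !inE => -> ->.
by rewrite convmm.
Qed.

(** Subgradients at points tending to [x] must tend to [v], and limits are unique; conversely,
    constant sequences reach [v]. *)
Lemma strictly_differentiable_limiting f x v :
  strictly_differentiable f x v -> limiting_subdiff f x = [set v].
Proof.
move=> fv; apply/seteqP; split=> [s [y_ [s_ [yx _ ys ss]]]|_ ->].
- have sv : s_ k @[k --> \oo] --> v.
    apply/cvgrPdist_le => e e0; near=> k.
    (* The subgradient is generalized so that the goal depends on [k] only through [y_ k], where the
       uniform estimate applies. *)
    rewrite distrC; have := ys k; move: (s_ k); near: k.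
    exact: yx (strictly_differentiable_frechet_near fv e0).
  exact: (cvg_unique _ ss sv).
- exists (fun=> x), (fun=> v); split=> [| |k|]; try exact: cvg_cst.
  exact/has_gradient_frechet_subdiff/strictly_differentiable_gradient.
Unshelve. all: by end_near. Qed.

Lemma strictly_differentiable_frechet f x v :
  strictly_differentiable f x v -> frechet_subdiff f x = [set v].
Proof.
move=> fv; apply/seteqP; split=> [s fs|_ ->].
- rewrite -(strictly_differentiable_limiting fv).
  by exists (fun=> x), (fun=> s); split=> [| |k|]; try exact: cvg_cst.
- exact/has_gradient_frechet_subdiff/strictly_differentiable_gradient.
Qed.

(** The set of limiting gradients is already [[set v]], so taking the convex hull adds nothing. *)
Lemma strictly_differentiable_clarke f x v :
  strictly_differentiable f x v -> clarke_subdiff f x = [set v].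
Proof.
move=> fv; rewrite -[RHS]convex_hull1; congr convex_hull.
have fg := strictly_differentiable_gradient fv.
apply/seteqP; split=> [s [y_ [g_ [yx yg gs]]]|_ ->].
- rewrite -(strictly_differentiable_limiting fv).
  exists y_, g_; split=> // [|k]; last exact: has_gradient_frechet_subdiff.
  (* The limiting subdifferential also asks for convergence of the values, which continuity of [f]
     at [x] supplies. *)
  by apply: continuous_cvg => //; apply: differentiable_continuous; case: fg.
- by exists (fun=> x), (fun=> v); split=> //; exact: cvg_cst.
Qed.

End StrictDifferentiability.

(** A Lipschitz constant that shrinks with the radius forces difference quotients to vanish: within
    radius [e / (2 * K)] the factor [K * (]|y| + [|z|)] is at most [e]. *)
Lemma strictly_differentiable0 (R : realType) (p q : nat)
    (f : 'M[R]_(p, q) -> R) (K : R) (U : set 'M[R]_(p, q)) :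
    0 < K -> nbhs (0 : 'M[R]_(p, q)) U ->
    (forall y z, U y -> U z ->
      `|f y - f z| <= K * (`|y| + `|z|) * `|y - z|) ->
  strictly_differentiable f 0 0.
Proof.
move=> K0 U0 fU; apply/strictly_differentiableP => e e0.
have small : \forall y \near (0 : 'M[R]_(p, q)), `|y| < e / (2 * K).
  by apply/nbhs_norm0P; exists (e / (2 * K)) => //=; rewrite divr_gt0 ?mulr_gt0.
pose V := U `&` [set y | `|y| < e / (2 * K)].
have V0 : nbhs (0 : 'M[R]_(p, q)) V by exact: filterI U0 small.
exists (V, V) => // -[y z] /= [[Uy ye] [Uz ze]].
rewrite frob_dot0l subr0 (le_trans (fU _ _ Uy Uz))// ler_pM//.
- by rewrite mulr_ge0 ?addr_ge0 ?(ltW K0).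
- rewrite mulrC -ler_pdivlMr// (le_trans (lerD (ltW ye) (ltW ze)))//.
  by rewrite invfM mulrCA -mulrDr -mulrDl mulrA; lra.
- exact: mx_norm_le_frob.
Qed.

(** * The quadratic map sending $(X, Y)$ to $X^{\mathrm T}Y$ *)

Section Factorization.
Context {R : realType} {m n d : nat}.
Implicit Types (W Z : 'M[R]_(d, m + n)).

Definition factor_product W : 'M[R]_(m, n) := (lsubmx W)^T *m rsubmx W.

Lemma factor_product0 : factor_product 0 = 0.
Proof. by rewrite /factor_product linear0 trmx0 mul0mx. Qed.

Lemma factor_product_lipschitz W Z :
  `|factor_product W - factor_product Z| <= d%:R * (`|W| + `|Z|) * `|W - Z|.
Proof.
apply: mx_norm_le => [|i j]; first by rewrite !mulr_ge0 ?addr_ge0.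
rewrite !mxE -sumrB (le_trans (ler_norm_sum _ _ _))//.
rewrite (le_trans (ler_sum _ (G := fun=> (`|W| + `|Z|) * `|W - Z|) _))//; last first.
  by rewrite sumr_const card_ord -mulrA mulr_natl.
move=> k _; rewrite !mxE; set a := lshift n i; set b := rshift m j.
(* A difference of products is split so that each term carries one entry of [W - Z]. *)
have -> : W k a * W k b - Z k a * Z k b =
    W k a * (W - Z) k b + Z k b * (W - Z) k a by rewrite !mxE; ring.
rewrite (le_trans (ler_normD _ _))// mulrDl !normrM.
by rewrite lerD// ler_pM// mx_entry_le.
Qed.

Lemma factor_product_continuous0 :
  factor_product W @[W --> (0 : 'M[R]_(d, m + n))] --> (0 : 'M[R]_(m, n)).
Proof.
apply/(@cvgr0Pnorm_le _ _ _ (nbhs (0 : 'M[R]_(d, m + n)))) => e e0.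
have d0 : 0 < d%:R + 1 :> R by rewrite ltr_wpDl.
have : \forall W \near (0 : 'M[R]_(d, m + n)), `|W| < Num.min 1 (e / (d%:R + 1)).
  by apply/nbhs_norm0P; exists (Num.min 1 (e / (d%:R + 1))) => //=;
    rewrite lt_min ltr01 divr_gt0.
apply: filterS => W; rewrite lt_min => /andP[W1 We].
rewrite -[factor_product W]subr0 -factor_product0.
rewrite (le_trans (factor_product_lipschitz _ _))// normr0 addr0 subr0.
rewrite (@le_trans _ _ (d%:R * `|W|))//.
  by rewrite ler_piMr ?mulr_ge0// ltW.
move: We; rewrite ltr_pdivlMr// => /ltW; apply: le_trans.
by rewrite mulrC ler_wpM2l// lerDl.
Qed.

End Factorization.

(* [row_mx X Y] identifies the pair (X, Y) with a d x (m + n) matrix. *)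
Theorem corollary3p4 (R : realType) (m n d : nat)
    (hm : (0 < m)%N) (hn : (0 < n)%N) (hd : (0 < d)%N)
    (ell : 'M[R]_(m, n) -> R) (hell : locally_lipschitz ell)
    (f : 'M[R]_(d, m + n) -> R)
    (hf : forall (X : 'M[R]_(d, m)) (Y : 'M[R]_(d, n)),
        f (row_mx X Y) = ell (X^T *m Y)) :
  [/\ clarke_subdiff f 0 = limiting_subdiff f 0,
      limiting_subdiff f 0 = frechet_subdiff f 0,
      frechet_subdiff f 0 = [set 0]
    & strictly_differentiable f 0 0].
Proof.
(* Every matrix is the [row_mx] of its two blocks, so [hf] determines [f] everywhere. *)
have fE W : f W = ell (factor_product W) by rewrite -hf hsubmxK.
suff f0 : strictly_differentiable f 0 0.
  by rewrite (strictly_differentiable_clarke f0)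
    (strictly_differentiable_limiting f0) (strictly_differentiable_frechet f0).
(* Being Lipschitz is stated for all large constants; a positive one is chosen. Only the behaviour
   of [ell] near 0 matters, as [factor_product] is small near the origin. *)
have [U U0 /pinfty_ex_gt0[M M0 ellM]] := hell 0.
have dR0 : 0 < d%:R :> R by rewrite ltr0n.
apply: (@strictly_differentiable0 _ _ _ _ (M * d%:R) (factor_product @^-1` U)).
- by rewrite mulr_gt0.
- exact: factor_product_continuous0.
- move=> y z Uy Uz; rewrite !fE.
  have := ellM (factor_product y, factor_product z) (conj Uy Uz).
  move=> /= /le_trans; apply.
  by rewrite -!mulrA ler_pM2l// mulrA factor_product_lipschitz.
Qed.
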